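(* Let $E$ be a finite set and let $\Gamma$ be a connected ribbon graph whose edges (ribbons) are labeled bijectively by $E$. Then $\rho_E(\Gamma)=\nu_E(\pi_E(\Gamma))$.
   Context: A ribbon graph is a surface given as a union of closed disks called vertices and closed disks called edges (ribbons, possibly twisted), such that vertices and edges meet in disjoint line segments, each such segment lies in exactly one edge and one vertex, and each edge contains exactly two such segments. $V_E$: the $\mathbb{F}_2$-vector space with basis $E\sqcup E^\vee$ ($E^\vee$ a disjoint copy of $E$, $e^\vee$ the copy of $e$, $Y^\vee=\{e^\vee: e\in Y\}$), with symplectic form $(e,e^\vee)=(e^\vee,e)=1$ and $0$ on other pairs of basis vectors. For a Lagrangian subspace $L\subset V_E$, $\nu_E(L)$ is the set system $(E;\Psi_L)$ with $\Psi_L=\{Y\subset E: L\cap\langle Y^\vee\sqcup(E\setminus Y)\rangle=0\}$. $\pi_E(\Gamma)$: remove a small open disk from the center of each vertex of $\Gamma$, obtaining a surface with boundary $F_\Gamma$. For $e\in E$, let $h_e\in H_1(F_\Gamma,\partial F_\Gamma;\mathbb{F}_2)$ be the class of a segment running along the edge $e$ joining the boundaries of the removed disks at its two end-vertices, and $h_{e^\vee}$ the class of a segment running across the edge $e$ joining its two opposite sides. To each closed curve $\gamma$ in $F_\Gamma$ assign the vector $\sum_{e\in E}\big((\gamma,h_e)\,e+(\gamma,h_{e^\vee})\,e^\vee\big)\in V_E$, where $(\cdot,\cdot)$ is the mod $2$ intersection pairing between $H_1(F_\Gamma)$ and $H_1(F_\Gamma,\partial F_\Gamma)$. The set of these vectors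 over all closed curves $\gamma$ is a Lagrangian subspace of $V_E$, denoted $\pi_E(\Gamma)$. $\rho_E(\Gamma)$: the set system $(E;\Phi)$ where $A\subset E$ is feasible iff the ribbon subgraph of $\Gamma$ consisting of all vertices and the edges in $A$ is a quasi-tree, i.e. its boundary is connected. *)

(* Defs.v *)
(* boolp only serves to turn a Prop-valued predicate on a finite type into a
   finite set. *)
From mathcomp Require Import all_boot all_order all_algebra.
From mathcomp Require Import perm boolp.

Set Implicit Arguments.
Unset Strict Implicit.
Unset Printing Implicit Defensive.

Import GRing.Theory.

Local Open Scope ring_scope.

(* Finite 2-dimensional cell complexes, with mod 2 coefficients: [face d] is the
   set of 1-cells that the boundary of the 2-cell d traverses an odd number of
   times. *)
Record complex := Complex {
  cell0 : finType;
  cell1 : finType;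
  cell2 : finType;
  src : cell1 -> cell0;
  tgt : cell1 -> cell0;
  face : cell2 -> {set cell1}
}.

Section Complexes.
Variable K : complex.

Definition touch (a b : cell1 K) : bool :=
  [|| src a == src b, src a == tgt b, tgt a == src b | tgt a == tgt b].

(* The union of the closed 1-cells in X is nonempty and connected. *)
Definition connected_cells (X : {set cell1 K}) : bool :=
  (X != set0) &&
  [forall a in X, forall b in X,
     connect [rel x y | [&& x \in X, y \in X & touch x y]] a b].

(* The boundary of the union of the closed 2-cells in D, when it is a surface. *)
Definition boundary (D : {set cell2 K}) : {set cell1 K} :=
  [set a | #|[set d in D | a \in face d]| == 1%N].

Definition chain := {ffun cell1 K -> 'F_2}.

Definition chain_of_set (X : {set cell1 K}) : chain :=
  [ffun a => (a \in X)%:R].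

Definition bound1 (x : chain) : {ffun cell0 K -> 'F_2} :=
  [ffun p => \sum_a x a * ((src a == p)%:R + (tgt a == p)%:R)].

(* A chain z also stands for the chain of dual 1-cells with coefficients z: the
   dual a* of a 1-cell a is an arc that crosses a once, meets no other 1-cell,
   and joins the centers of the 2-cells on either side of a; if a lies on the
   boundary of the surface, a* ends on that boundary.  Modulo the boundary of
   the surface, the dual cells form the relative chain complex of the dual
   decomposition: [dual_bound1] is its differential from dual 1-cells to centers
   of 2-cells, and [dual_bound2 p] the boundary of the 2-cell dual to p. *)
Definition dual_bound1 (z : chain) : {ffun cell2 K -> 'F_2} :=
  [ffun d => \sum_(a in face d) z a].

Definition dual_bound2 (p : cell0 K) : chain :=
  [ffun a => (src a == p)%:R + (tgt a == p)%:R].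

Lemma bound1_set (X : {set cell1 K}) p :
  bound1 (chain_of_set X) p =
  \sum_(a in X) ((src a == p)%:R + (tgt a == p)%:R).
Proof.
rewrite ffunE [RHS]big_mkcond; apply: eq_bigr => a _.
by rewrite ffunE; case: ifP; rewrite ?mul1r ?mul0r.
Qed.

Lemma dual_bound1_set (X : {set cell1 K}) d :
  dual_bound1 (chain_of_set X) d = \sum_(a in X) (a \in face d)%:R.
Proof.
rewrite ffunE big_mkcond [RHS]big_mkcond; apply: eq_bigr => a _.
by rewrite ffunE; do 2 case: (_ \in _).
Qed.

(* Mod 2 intersection number of the chain x with the dual chain z.  By the next
   two lemmas it only depends on the homology class of the cycle x and on the
   relative homology class of the relative cycle z. *)
Definition pairing (x z : chain) : 'F_2 := \sum_a x a * z a.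

Lemma pairing_face d (z : chain) :
  dual_bound1 z = 0 -> pairing (chain_of_set (face d)) z = 0.
Proof.
move=> /ffunP/(_ d); rewrite !ffunE => <-; rewrite /pairing [RHS]big_mkcond /=.
by apply: eq_bigr => a _; rewrite ffunE; case: ifP; rewrite ?mul1r ?mul0r.
Qed.

Lemma pairing_dual_bound2 p (x : chain) :
  bound1 x = 0 -> pairing x (dual_bound2 p) = 0.
Proof.
move=> /ffunP/(_ p); rewrite !ffunE => <-.
by apply: eq_bigr => a _; rewrite ffunE.
Qed.

(* Closed curves as closed edge paths: (a, true) is the 1-cell a traversed from
   src a to tgt a, (a, false) is a traversed backwards, and the empty path is a
   constant curve. *)
Definition o_tail (o : cell1 K * bool) := if o.2 then src o.1 else tgt o.1.
Definition o_head (o : cell1 K * bool) := if o.2 then tgt o.1 else src o.1.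

Definition closed_curve (s : seq (cell1 K * bool)) : bool :=
  cycle [rel o1 o2 | o_head o1 == o_tail o2] s.

Definition chain_of_curve (s : seq (cell1 K * bool)) : chain :=
  [ffun a => (count (fun o => o.1 == a) s)%:R].

Lemma addFF (x : 'F_2) : x + x = 0.
Proof. by rewrite -mulr2n -mulr_natr pchar_Zp ?mulr0. Qed.

Lemma bound1_curve s : closed_curve s -> bound1 (chain_of_curve s) = 0.
Proof.
move=> cs; apply/ffunP=> p; rewrite !ffunE.
have sumE t : \sum_a chain_of_curve t a * ((src a == p)%:R + (tgt a == p)%:R)
            = \sum_(o <- t) ((o_tail o == p)%:R + (o_head o == p)%:R) :> 'F_2.
  elim: t => [|[b c] t IH].
    by rewrite big_nil big1 // => a _; rewrite ffunE mul0r.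
  rewrite big_cons -IH [in RHS](bigD1 b) //= (bigD1 b) //= addrA; congr (_ + _).
    rewrite !ffunE /= eqxx natrD mulrDl mul1r; congr (_ + _).
    by rewrite /o_tail /o_head; case: c => //=; rewrite addrC.
  by apply: eq_bigr => a nab; rewrite !ffunE /= eq_sym (negPf nab).
have pathE o t : path [rel o1 o2 | o_head o1 == o_tail o2] o t ->
    \sum_(o' <- t) ((o_tail o' == p)%:R + (o_head o' == p)%:R)
      = (o_head o == p)%:R + (o_head (last o t) == p)%:R :> 'F_2.
  elim: t o => [|o' t IH] o /=; first by rewrite big_nil addFF.
  case/andP=> /eqP -> /IH sum_t; rewrite big_cons sum_t.
  by rewrite -addrA [X in _ + X]addrA addFF add0r.
rewrite sumE; case: s cs {sumE} => [|o s] /= cs; first by rewrite big_nil.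
have := pathE _ _ cs; rewrite last_rcons addFF; apply: etrans.
by apply: perm_big; rewrite perm_sym; apply/permPl/perm_rcons.
Qed.

End Complexes.

(* A ribbon graph with edges labelled by E.  The ribbon e is a square with
   corners (e, i, s): it is attached to vertices along its two ends (e, i), i
   in bool, where (e, i) is the segment from (e, i, false) to (e, i, true), and
   it has two free sides (e, s), from (e, false, s) to (e, true, s).
   The boundary circle of each vertex disk is given a direction (any will do):
   following it, the end h is followed by the end [rot h], and is traversed from
   the corner (h, entry h) to the corner (h, ~~ entry h).  The choice of entry
   corners encodes the twists of the ribbons; no orientability is assumed.
   A vertex that is not in the image of [at_vert] is a disk without edges. *)
Record ribbon_graph (E : finType) := RibbonGraph {
  vert : finType;
  at_vert : E * bool -> vert;
  rot : {perm E * bool};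
  entry : E * bool -> bool;
  at_vertP : forall h k, (at_vert h == at_vert k) = (k \in porbit rot h)
}.

Section RibbonGraph.
Variables (E : finType) (G : ribbon_graph E).

Definition bare_vert := {v : vert G | v \notin codom (@at_vert E G)}.

(* Subdivision of the boundary circles of the vertex disks.  The points are the
   corners of the ribbons, and one base point on each disk without edges.  The
   1-cells are: [rim_seg h], the end h of a ribbon; [rim_arc h], the arc from the
   end h to the next one; and [rim_loop v], the whole circle of a disk without
   edges. *)
Definition point : finType := ((E * bool) * bool + bare_vert)%type.
Definition rim : finType := ((E * bool) + (E * bool) + bare_vert)%type.
Definition rim_seg (h : E * bool) : rim := inl (inl h).
Definition rim_arc (h : E * bool) : rim := inl (inr h).
Definition rim_loop (v : bare_vert) : rim := inr v.

Definition rim_src (r : rim) : point :=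
  match r with
  | inl (inl h) => inl (h, entry G h)
  | inl (inr h) => inl (h, ~~ entry G h)
  | inr v => inr v
  end.

Definition rim_tgt (r : rim) : point :=
  match r with
  | inl (inl h) => inl (h, ~~ entry G h)
  | inl (inr h) => inl (rot G h, entry G (rot G h))
  | inr v => inr v
  end.

Definition rim_vert (r : rim) : vert G :=
  match r with
  | inl (inl h) => at_vert G h
  | inl (inr h) => at_vert G h
  | inr v => val v
  end.

(* The surface G: 1-cells are rims and sides of ribbons, 2-cells are vertex
   disks and ribbons. *)
Definition surface_src (a : rim + E * bool) : point :=
  match a with
  | inl r => rim_src r
  | inr (e, s) => inl ((e, false), s)
  end.

Definition surface_tgt (a : rim + E * bool) : point :=
  match a with
  | inl r => rim_tgt r
  | inr (e, s) => inl ((e, true), s)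
  end.

Definition surface_face (d : vert G + E) : {set rim + E * bool} :=
  match d with
  | inl v => [set inl r | r : rim & rim_vert r == v]
  | inr e => [set inl (rim_seg (e, false)); inl (rim_seg (e, true));
                  inr (e, false); inr (e, true)]
  end.

Definition surface : complex := Complex surface_src surface_tgt surface_face.

Definition connected_ribbon_graph : bool := connected_cells [set: cell1 surface].

Definition ribbon_subgraph (A : {set E}) : {set cell2 surface} :=
  [set d | match d with inl _ => true | inr e => e \in A end].

Definition quasi_tree (A : {set E}) : bool :=
  connected_cells (boundary (ribbon_subgraph A)).

Definition rho_E : {set {set E}} := [set A | quasi_tree A].

(* The surface F of G: each vertex disk becomes an annulus, between the boundary
   circle of the disk (level false) and the boundary of the removed disk (level
   true), subdivided in the same way.  The annulus is cut into squares by the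
   segments [ray p] joining the two copies of p.  The annulus of a disk without
   edges is cut along a single ray, which its only 2-cell has on both sides. *)
Definition annular_cell1 : finType := (rim * bool + point + E * bool)%type.
Definition circle (b : bool) (r : rim) : annular_cell1 := inl (inl (r, b)).
Definition ray (p : point) : annular_cell1 := inl (inr p).
Definition side (e : E) (s : bool) : annular_cell1 := inr (e, s).

Definition annular_src (a : annular_cell1) : point * bool :=
  match a with
  | inl (inl (r, b)) => (rim_src r, b)
  | inl (inr p) => (p, false)
  | inr (e, s) => (inl ((e, false), s), false)
  end.

Definition annular_tgt (a : annular_cell1) : point * bool :=
  match a with
  | inl (inl (r, b)) => (rim_tgt r, b)
  | inl (inr p) => (p, true)
  | inr (e, s) => (inl ((e, true), s), false)
  end.

Definition annular_face (d : rim + E) : {set annular_cell1} :=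
  match d with
  | inl r =>
      [set circle false r; circle true r] :|:
      (if rim_src r == rim_tgt r then set0
       else [set ray (rim_src r); ray (rim_tgt r)])
  | inr e => [set circle false (rim_seg (e, false));
                  circle false (rim_seg (e, true));
                  side e false; side e true]
  end.

Definition annular_surface : complex :=
  Complex annular_src annular_tgt annular_face.

Lemma cell_eqE :
  (forall b r b' r',
     (circle b r == circle b' r') = (r == r') && (b == b'))
  * (forall p p', (ray p == ray p') = (p == p'))
  * (forall e s e' s', (side e s == side e' s') = (e == e') && (s == s'))
  * (forall b r p, (circle b r == ray p) = false)
  * (forall b r e s, (circle b r == side e s) = false)
  * (forall p b r, (ray p == circle b r) = false)
  * (forall p e s, (ray p == side e s) = false)
  * (forall e s b r, (side e s == circle b r) = false)
  * (forall e s p, (side e s == ray p) = false)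
  * (forall h k, (rim_seg h == rim_seg k) = (h == k)).
Proof. by []. Qed.

Lemma bound1_annular_face (d : cell2 annular_surface) :
  bound1 (chain_of_set (face d)) = 0.
Proof.
apply/ffunP=> p; rewrite bound1_set ffunE; case: d => [r|e] /=.
  case: (altP (rim_src r =P rim_tgt r)) => [st|st].
    rewrite setU0 big_setU1 ?big_set1 ?inE ?cell_eqE ?andbF //= st.
    by rewrite !addFF.
  rewrite -?setUA !big_setU1 ?big_set1 ?inE ?cell_eqE ?andbF ?eqxx //=.
  by do 4 case: (_ == p); apply/eqP.
rewrite -?setUA !big_setU1 ?big_set1 ?inE ?cell_eqE ?xpair_eqE ?eqxx ?andbF //=.
case: (entry G (e, false)); case: (entry G (e, true)) => /=;
  by do 4 case: (_ == p); apply/eqP.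
Qed.

(* Each class is given as a dual chain.  A segment along the ribbon e, from one
   removed disk to the other, crosses for each end of e its copies at both
   levels; a segment across e crosses the two sides of e. *)
Definition h_along (e : E) : chain annular_surface :=
  chain_of_set (K := annular_surface)
    [set circle true (rim_seg (e, false)); circle false (rim_seg (e, false));
         circle false (rim_seg (e, true)); circle true (rim_seg (e, true))].

Definition h_across (e : E) : chain annular_surface :=
  chain_of_set (K := annular_surface) [set side e false; side e true].

Lemma dual_bound1_along e : dual_bound1 (h_along e) = 0.
Proof.
apply/ffunP=> d; rewrite dual_bound1_set ffunE -?setUA !big_setU1 ?big_set1;
  rewrite ?inE ?cell_eqE ?xpair_eqE ?eqxx ?andbF //=.
case: d => [r|e'] /=; last first.
  rewrite !inE ?cell_eqE ?xpair_eqE /= ?andbF ?andbT ?orbF /=.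
  by case: (_ == _); apply/eqP.
by case: ifP => _; rewrite !inE ?cell_eqE ?andbF ?andbT ?orbF /=;
  case: (_ == r); case: (_ == r); apply/eqP.
Qed.

Lemma dual_bound1_across e : dual_bound1 (h_across e) = 0.
Proof.
apply/ffunP=> d; rewrite dual_bound1_set ffunE -?setUA !big_setU1 ?big_set1;
  rewrite ?inE ?cell_eqE ?xpair_eqE ?eqxx ?andbF //=.
case: d => [r|e'] /=; last first.
  rewrite !inE ?cell_eqE ?xpair_eqE /= ?andbF ?andbT ?orbF /=.
  by case: (_ == _); apply/eqP.
by case: ifP => _; rewrite !inE ?cell_eqE ?andbF ?andbT ?orbF /=;
  apply/eqP.
Qed.

End RibbonGraph.

(* Vectors over the disjoint union of E (inl) and its copy (inr). *)
Notation VE E := {ffun E + E -> ('F_2)^o}.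

Section SetSystems.
Variable E : finType.

Definition basis_vec (x : E + E) : VE E := [ffun y => (y == x)%:R].
Definition vec (e : E) : VE E := basis_vec (inl e).
Definition dvec (e : E) : VE E := basis_vec (inr e).

Definition coord_space (Y : {set E}) : {vspace VE E} :=
  <<[seq dvec e | e in Y] ++ [seq vec e | e in ~: Y]>>%VS.

(* Only used for Lagrangian subspaces L, but the formula makes sense for any
   set of vectors. *)
Definition nu_E (L : {set VE E}) : {set {set E}} :=
  [set Y | [set v in L | v \in coord_space Y] == [set 0 : VE E]].

Definition curve_vec (G : ribbon_graph E)
    (s : seq (cell1 (annular_surface G) * bool)) : VE E :=
  \sum_e (pairing (chain_of_curve s) (h_along G e) *: vec e
          + pairing (chain_of_curve s) (h_across G e) *: dvec e).

Definition pi_E (G : ribbon_graph E) : {set VE E} :=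
  [set v | `[< exists2 s, closed_curve s & v = curve_vec (G := G) s >]].

End SetSystems.

(* Main.v *)
(* Collapsing each annulus onto the rim of its vertex disk turns cycles of F into
   cycles of the cubic graph whose vertices are the corners of the ribbons and
   whose edges are the rim arcs, the ends and the sides of the ribbons; as G is
   connected, every cycle of this graph comes from a closed curve.  The boundary
   of the subgraph A is a union of circles of this graph, which leaves out the
   ends of the ribbons in A and the sides of the others.  A nonzero element of L
   in the coordinate space of A amounts to a cycle carried by this boundary other
   than 0 and the whole boundary, so it exists if and only if the boundary is
   disconnected. *)

From mathcomp Require Import all_boot all_algebra perm boolp.
Require Import Defs.

Set Implicit Arguments.
Unset Strict Implicit.
Unset Printing Implicit Defensive.

Import GRing.Theory.

Local Open Scope ring_scope.

(** * Arithmetic in the field with two elements *)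

Lemma F2_neq0 (x : 'F_2) : x != 0 -> x = 1.
Proof. by case: x => [[|[|[]]] //= i] _; apply/val_inj. Qed.

Lemma F2_addr_eq0 (x y : 'F_2) : x + y = 0 -> x = y.
Proof. by move=> xy; rewrite -[x]addr0 -(addFF y) addrA xy add0r. Qed.

Lemma F2_bool_inj (b c : bool) : b%:R = c%:R :> 'F_2 -> b = c.
Proof. by case: b; case: c => // /eqP. Qed.

Lemma sum_pick (T : finType) (f : T -> 'F_2) k :
  \sum_i f i * (i == k)%:R = f k.
Proof.
rewrite (bigD1 k) //= eqxx mulr1 big1 ?addr0 // => i /negPf ->.
by rewrite mulr0.
Qed.

(** * Walks, closed curves and cycles in a complex *)

Section Curves.
Variable K : complex.
Implicit Types (p q : cell0 K) (s t : seq (cell1 K * bool)) (x : chain K).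

(** Touching cells share an extremity, where [g] gives the value of [f] on both; this value is
    carried along a path of touching cells in X. *)
Lemma connected_cells_const (T : Type) (X : {set cell1 K})
    (f : cell1 K -> T) (g : cell0 K -> T) :
  connected_cells X ->
  (forall a, a \in X -> f a = g (src a) /\ f a = g (tgt a)) ->
  {in X &, forall a b, f a = f b}.
Proof.
case/andP=> _ /forall_inP conX fg a b aX bX.
have /connectP [w aw ->] := forall_inP (conX a aX) b bX.
elim: w a aw {aX} => //= c w IH a /andP[/and3P[aX cX touch_ac] /IH <-].
have [fa fa'] := fg _ aX; have [fc fc'] := fg _ cX.
case/or4P: touch_ac => /eqP e; first [by rewrite fa e fc | by rewrite fa e fc'
  | by rewrite fa' e fc | by rewrite fa' e fc'].
Qed.

Fixpoint walk p s q : bool :=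
  if s is o :: t then (o_tail o == p) && walk (o_head o) t q else p == q.

Lemma walk_cat p q r s t : walk p s q -> walk q t r -> walk p (s ++ t) r.
Proof.
by elim: s p => [|o s IH] p /=; [move/eqP-> | case/andP=> -> /IH h /h].
Qed.

Lemma walk_path o s q :
  walk (o_head o) s q ->
  path [rel o1 o2 | o_head o1 == o_tail o2] o s /\ o_head (last o s) = q.
Proof.
elim: s o => [|o' s IH] o /=; first by move/eqP.
by rewrite eq_sym; case/andP=> -> /IH.
Qed.

Lemma walk_closed p s : walk p s p -> closed_curve s.
Proof.
case: s => [//|o s] /= /andP[/eqP op /walk_path[os lp]].
by rewrite /closed_curve /= rcons_path os /= lp op.
Qed.

Lemma chain_of_curve_nil : chain_of_curve [::] = 0 :> chain K.
Proof. by apply/ffunP=> a; rewrite !ffunE. Qed.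

Lemma chain_of_curve_cat s t :
  chain_of_curve (s ++ t) = chain_of_curve s + chain_of_curve t.
Proof. by apply/ffunP=> a; rewrite !ffunE count_cat natrD. Qed.

(** Mod 2 chains forget the direction in which a cell is traversed. *)
Lemma walk_rev p q s :
  walk p s q -> exists2 t, walk q t p & chain_of_curve t = chain_of_curve s.
Proof.
elim: s p => [|[a c] s IH] p /=; first by move/eqP->; exists [::] => /=.
case/andP=> /eqP ap /IH [t wt ts]; exists (t ++ [:: (a, ~~ c)]).
  apply: walk_cat wt _; move: ap; rewrite /= /o_tail /o_head /=.
  by case: (c) => /= ->; rewrite !eqxx.
rewrite chain_of_curve_cat ts; apply/ffunP=> b.
by rewrite !ffunE /= addn0 natrD addrC.
Qed.

Definition adjacent p q : bool :=
  [exists a : cell1 K, ((src a == p) && (tgt a == q))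
                       || ((src a == q) && (tgt a == p))].

Lemma adjacent_sym : symmetric adjacent.
Proof. by move=> p q; apply: eq_existsb => a; rewrite orbC. Qed.

Lemma connect_cell p a : connect adjacent p (src a) = connect adjacent p (tgt a).
Proof.
rewrite (same_connect_r (sym_connect_sym adjacent_sym) (y := tgt a)) //.
by apply: connect1; apply/existsP; exists a; rewrite !eqxx.
Qed.

Lemma connect_walk p q : connect adjacent p q -> exists s, walk p s q.
Proof.
case/connectP=> w; elim: w p => [|r w IH] p /=.
  by move=> _ ->; exists [::] => /=.
case/andP=> /existsP[a pr] /IH h /h [s ws].
case/orP: pr => /andP[/eqP e1 /eqP e2].
  by exists ((a, true) :: s); rewrite /= /o_tail /o_head /= e1 eqxx e2.
by exists ((a, false) :: s); rewrite /= /o_tail /o_head /= e2 eqxx e1.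
Qed.

(* With walks w_p from a base point to p, the closed walks w_src(a) a w_tgt(a)^-1
   summed over the cells a of a cycle give back the cycle: each w_p is counted as
   often as p occurs in the boundary of the cycle, that is, an even number of
   times. *)
Lemma cycle_curve (x : chain K) :
  (forall p q, connect adjacent p q) -> bound1 x = 0 ->
  exists2 s, closed_curve s & chain_of_curve s = x.
Proof.
move=> conn x0.
have [a0 _|no_cell] := pickP (@predT (cell1 K)); last first.
  exists [::] => //; rewrite chain_of_curve_nil.
  by apply/ffunP=> a; have := no_cell a.
have [w ww] := choice (fun p => connect_walk (conn (src a0) p)).
(* All walks are based at the same point, so that they can be concatenated and [P] is stable under
   sums. *)
pose P y := exists2 s, walk (src a0) s (src a0) & chain_of_curve s = y.
suff [s ws <-] : P x by exists s => //; apply: walk_closed ws.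
have -> : x = \sum_(a | x a != 0) (chain_of_curve (w (src a))
     + chain_of_curve [:: (a, true)] + chain_of_curve (w (tgt a))).
  apply/ffunP=> b; rewrite sum_ffunE.
  transitivity (x b + \sum_a x a * (chain_of_curve (w (src a)) b
                        + chain_of_curve (w (tgt a)) b)).
    rewrite -[LHS]addr0; congr (_ + _).
    transitivity (\sum_p bound1 x p * chain_of_curve (w p) b).
      by rewrite x0 big1 // => p _; rewrite ffunE mul0r.
    under eq_bigr do rewrite ffunE mulr_suml.
    rewrite exchange_big; apply: eq_bigr => a _ /=.
    under eq_bigr do rewrite -mulrA.
    rewrite -mulr_sumr; congr (_ * _).
    rewrite -(sum_pick (fun p => chain_of_curve (w p) b) (src a)).
    rewrite -(sum_pick (fun p => chain_of_curve (w p) b) (tgt a)) -big_split.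
    apply: eq_bigr => p _ /=; rewrite mulrC mulrDr.
    by rewrite (eq_sym p) (eq_sym p).
  rewrite -{1}(sum_pick x b) -big_split /= [RHS]big_mkcond; apply: eq_bigr => a _.
  case: (eqVneq (x a) 0) => [->|/F2_neq0 ->]; first by rewrite !mul0r addr0.
  by rewrite !mul1r !ffunE /= addn0 addrA [_%:R + _]addrC.
apply: (big_ind P); first by exists [::]; rewrite ?chain_of_curve_nil /=.
  move=> y z [s ws <-] [t wt <-]; exists (s ++ t); first exact: walk_cat wt.
  by rewrite chain_of_curve_cat.
move=> a _; have [t wt ct] := walk_rev (ww (tgt a)).
exists (w (src a) ++ [:: (a, true)] ++ t).
  apply: walk_cat (ww _) _; apply: walk_cat wt.
  by rewrite /= /o_tail /o_head /= !eqxx.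
by rewrite !chain_of_curve_cat ct addrA.
Qed.

End Curves.

(** * The cubic graph of rims and sides, and its cycles *)

Section Surfaces.
Variables (E : finType) (G : ribbon_graph E).
Implicit Types (e : E) (h : E * bool) (A : {set E}).

Local Notation S := (surface G).
Local Notation F := (annular_surface G).
Local Notation seg h := (inl (rim_seg G h) : cell1 S).
Local Notation arc h := (inl (rim_arc G h) : cell1 S).
Local Notation loop v := (inl (rim_loop v) : cell1 S).
Local Notation rib_side e s := (inr (e, s) : cell1 S).

(* rim_arc (arc_end c) is the arc with an extremity at the corner c. *)
Definition arc_end (c : (E * bool) * bool) : E * bool :=
  if c.2 == entry G c.1 then (rot G)^-1%g c.1 else c.1.

Lemma arc_end_src h : arc_end (h, ~~ entry G h) = h.
Proof. by rewrite /arc_end /=; case: (entry G h). Qed.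

Lemma arc_end_tgt h : arc_end (rot G h, entry G (rot G h)) = h.
Proof. by rewrite /arc_end eqxx permK. Qed.

Lemma sum_cells (f : cell1 S -> 'F_2) :
  \sum_a f a = \sum_h f (seg h) + \sum_h f (arc h) + \sum_v f (loop v)
               + \sum_(es : E * bool) f (inr es).
Proof. by rewrite !big_sumType. Qed.

(** Three cells meet at each corner, and none of them is a loop: an end, a side and a rim arc. *)
Lemma bound1_corner (x : chain S) (c : (E * bool) * bool) :
  bound1 x (inl c)
    = x (seg c.1) + x (arc (arc_end c)) + x (rib_side c.1.1 c.2).
Proof.
have inlE (c1 c2 : (E * bool) * bool) :
  (inl c1 == inl c2 :> point G) = (c1 == c2) by [].
rewrite ffunE sum_cells [X in _ + X + _]big1 ?addr0; last first.
  by move=> v _; rewrite addr0 mulr0.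
case: c => [[e i] s].
rewrite -(sum_pick (fun h => x (seg h)) (e, i)).
rewrite -(sum_pick (fun h => x (arc h)) (arc_end _)).
rewrite -(sum_pick (fun es => x (inr es)) (e, s)).
congr (_ + _ + _); apply: eq_bigr => h _; congr (_ * _).
- rewrite /= !inlE ![_ == (e, i, s)]xpair_eqE.
  case: (h =P (e, i)) => [->|_] //=; last by rewrite addr0.
  by case: (entry G _); case: s; rewrite ?addr0 ?add0r.
- rewrite /= !inlE ![_ == (e, i, s)]xpair_eqE /arc_end /=.
  (* The entry corner of an end is the target of one arc and the source of none; for the other
     corner it is the reverse. *)
  case: (eqVneq s (entry G (e, i))) => [->|se] /=.
    have -> : (h == (rot G)^-1%g (e, i)) = (rot G h == (e, i)).
      by apply/eqP/eqP => [->|<-]; rewrite ?permKV ?permK.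
    have -> : (h == (e, i)) && (~~ entry G h == entry G (e, i)) = false.
      by apply/andP=> -[/eqP ->]; case: (entry G _).
    by case: (rot G h =P (e, i)) => [->|_] /=; rewrite ?eqxx add0r.
  have -> : (rot G h == (e, i)) && (entry G (rot G h) == s) = false.
    by apply/andP=> -[/eqP -> /eqP es]; rewrite es eqxx in se.
  rewrite addr0; case: (h =P (e, i)) => [->|_] //=.
  by move: se; case: s; case: (entry G _).
- case: h => e' s' /=; rewrite !inlE !xpair_eqE.
  by case: (e' == e); case: (s' == s); case: i; rewrite /= ?addr0 ?add0r.
Qed.

(** The only cell at this point is a loop, whose two extremities cancel mod 2. *)
Lemma bound1_bare (x : chain S) (v : bare_vert G) : bound1 x (inr v) = 0.
Proof.
rewrite ffunE sum_cells !big1 ?addr0 // => [[e s]|u|h|h] _ /=;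
  by rewrite ?addr0 ?mulr0 // addFF mulr0.
Qed.

Lemma bound1_eq0 (x : chain S) :
  (forall c : (E * bool) * bool,
     x (seg c.1) + x (arc (arc_end c)) + x (rib_side c.1.1 c.2) = 0) ->
  bound1 x = 0.
Proof.
move=> cx; apply/ffunP=> -[c|v]; rewrite [RHS]ffunE ?bound1_bare //.
by rewrite bound1_corner cx.
Qed.

Lemma cycle_corner (x : chain S) (c : (E * bool) * bool) : bound1 x = 0 ->
  x (arc (arc_end c)) = x (seg c.1) + x (rib_side c.1.1 c.2).
Proof.
move=> x0; apply/esym/F2_addr_eq0; rewrite addrAC -bound1_corner x0.
by rewrite ffunE.
Qed.

(** * Passing between the annular surface and the surface *)

Definition collapse (z : chain F) : chain S :=
  [ffun a => match a with
             | inl r => z (circle false r) + z (circle true r)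
             | inr (e, s) => z (side G e s)
             end].

(** A right inverse of [collapse]: the chain is placed at level false, where the ribbons are
    attached. *)
Definition lift (x : chain S) : chain F :=
  [ffun a => match a with
             | inl (inl (r, b)) => if b then 0 else x (inl r)
             | inl (inr _) => 0
             | inr es => x (inr es)
             end].

Lemma lift_collapse (x : chain S) : collapse (lift x) = x.
Proof. by apply/ffunP=> -[r|[e s]]; rewrite !ffunE ?addr0. Qed.

Lemma sum_annular_cells (f : cell1 F -> 'F_2) :
  \sum_a f a = \sum_r (f (circle false r) + f (circle true r))
               + \sum_p f (ray p) + \sum_(es : E * bool) f (inr es).
Proof.
rewrite [LHS]big_sumType [X in X + _ = _]big_sumType /=; congr (_ + _ + _).
transitivity (\sum_r \sum_b f (circle b r)).
  by rewrite pair_bigA; apply: eq_bigr => -[].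
by apply: eq_bigr => r _; rewrite big_bool addrC.
Qed.

Lemma bound1_collapse (z : chain F) : bound1 z = 0 -> bound1 (collapse z) = 0.
Proof.
move=> z0; apply/ffunP=> p.
(* Both levels of p collapse to p, and the ray joining them contributes twice. *)
have -> : bound1 (collapse z) p = bound1 z (p, false) + bound1 z (p, true).
  rewrite !ffunE -big_split sum_annular_cells /=.
  rewrite [X in _ + X + _]big1 ?addr0; last first.
    move=> q _; rewrite !xpair_eqE /= !andbT !andbF addr0 add0r.
    by rewrite -mulrDr addFF mulr0.
  rewrite [LHS]big_sumType /=; congr (_ + _); apply: eq_bigr.
    move=> r _; rewrite !ffunE !xpair_eqE /= !andbT !andbF !addr0 !mulr0.
    by rewrite addr0 add0r mulrDl.
  move=> [e s] _; rewrite !ffunE !xpair_eqE /= !andbT !andbF.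
  by rewrite addr0 mulr0 addr0.
by rewrite z0 !ffunE addr0.
Qed.

Lemma bound1_lift (x : chain S) : bound1 x = 0 -> bound1 (lift x) = 0.
Proof.
move=> x0; apply/ffunP=> -[p b].
transitivity (if b then 0 else bound1 x p); last by rewrite x0 !ffunE if_same.
rewrite ffunE sum_annular_cells [X in _ + X + _]big1 ?addr0; last first.
  by move=> q _; rewrite ffunE mul0r.
case: b; last first.
  rewrite ffunE [RHS]big_sumType /=; congr (_ + _); apply: eq_bigr.
    by move=> r _; rewrite !ffunE mul0r addr0 !xpair_eqE /= !andbT.
  by move=> [e s] _; rewrite !ffunE !xpair_eqE /= !andbT.
rewrite !big1 ?addr0 // => [[e s]|r] _; rewrite !ffunE ?mul0r !xpair_eqE /=;
  by rewrite !andbF !addr0 mulr0.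
Qed.

(** * Intersection vectors and coordinate subspaces *)

Definition surface_vec (x : chain S) : VE E :=
  [ffun y => match y with
             | inl e => x (seg (e, false)) + x (seg (e, true))
             | inr e => x (rib_side e false) + x (rib_side e true)
             end].

Lemma sum_basis_vec (a b : E -> 'F_2) (y : E + E) :
  (\sum_e (a e *: vec e + b e *: dvec e)) y
    = match y with inl e => a e | inr e => b e end.
Proof.
rewrite sum_ffunE.
transitivity (\sum_e (a e * (y == inl e)%:R + b e * (y == inr e)%:R)).
  apply: eq_bigr => e _.
  by rewrite [LHS]ffunE; congr (_ + _); rewrite [LHS]ffunE [X in _ *: X]ffunE.
case: y => e; rewrite big_split /=.
  rewrite [X in _ + X]big1 ?addr0; last by move=> e' _; rewrite mulr0.
  by rewrite -[RHS](sum_pick a e); apply: eq_bigr => e' _; rewrite eq_sym.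
rewrite [X in X + _]big1 ?add0r; last by move=> e' _; rewrite mulr0.
by rewrite -[RHS](sum_pick b e); apply: eq_bigr => e' _; rewrite eq_sym.
Qed.

(** The segment along e crosses each end at both levels, and [collapse] adds exactly these two
    values. *)
Lemma curve_vecE (s : seq (cell1 F * bool)) :
  curve_vec (G := G) s = surface_vec (collapse (chain_of_curve s)).
Proof.
have pairing_set (x : chain F) (X : {set cell1 F}) :
    pairing x (chain_of_set X) = \sum_(a in X) x a.
  rewrite /pairing [RHS]big_mkcond /=; apply: eq_bigr => a _.
  by rewrite ffunE; case: ifP; rewrite ?mulr0 ?mulr1.
rewrite /curve_vec; move: (chain_of_curve s) => x.
have alongE e : pairing x (h_along G e) = surface_vec (collapse x) (inl e).
  rewrite pairing_set -!setUA !big_setU1 ?big_set1 ?inE ?cell_eqE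
    ?xpair_eqE ?eqxx ?andbF //= !ffunE.
  by rewrite addrA (addrC (x (circle true _))).
have acrossE e : pairing x (h_across G e) = surface_vec (collapse x) (inr e).
  rewrite pairing_set !big_setU1 ?big_set1 ?inE ?cell_eqE ?eqxx ?andbF //=.
  by rewrite !ffunE.
apply/ffunP=> y; rewrite sum_basis_vec.
by case: y => e; rewrite ?alongE ?acrossE.
Qed.

Lemma coord_spaceP (Y : {set E}) (v : VE E) :
  reflect ((forall e, e \in Y -> v (inl e) = 0)
           /\ (forall e, e \notin Y -> v (inr e) = 0))
          (v \in coord_space Y).
Proof.
rewrite /coord_space; set X := _ ++ _.
apply: (iffP idP) => [vX|[vY vC]].
  suff zeroX y : {in X, forall u : VE E, u y = 0} -> v y = 0.
    split=> e eY; apply: zeroX => u; rewrite mem_cat => /orP[] /imageP[e' e'Y ->];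
      rewrite ffunE //; case: eqP => // -[ee'];
      by move: e'Y; rewrite -ee' ?inE ?eY ?(negPf eY).
  rewrite (coord_span (X := in_tuple X) vX).
  move=> X0; rewrite sum_ffunE big1 // => i _.
  by rewrite ffunE X0 ?mem_nth // scaler0.
have -> : v = \sum_e (v (inl e) *: vec e + v (inr e) *: dvec e).
  by apply/ffunP=> y; rewrite sum_basis_vec; case: y.
apply: rpred_sum => e _; case: (boolP (e \in Y)) => eY.
  rewrite vY // scale0r add0r rpredZ // memv_span // mem_cat.
  by apply/orP; left; apply/imageP; exists e.
rewrite vC // scale0r addr0 rpredZ // memv_span // mem_cat.
by apply/orP; right; apply/imageP; exists e; rewrite ?inE.
Qed.

(** * Boundary cells of a ribbon subgraph *)

Lemma rim_in_vert (r : rim G) v :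
  ((inl r : cell1 S) \in face (inl v : cell2 S)) = (v == rim_vert r).
Proof.
apply/imsetP/eqP => [[r' r'v [->]]|->]; first by rewrite inE in r'v; apply/esym/eqP.
by exists r; rewrite ?inE.
Qed.

Lemma side_in_vert (es : E * bool) v :
  ((inr es : cell1 S) \in face (inl v : cell2 S)) = false.
Proof. by apply/imsetP=> -[]. Qed.

Lemma rim_in_ribbon (r : rim G) e :
  ((inl r : cell1 S) \in face (inr e : cell2 S))
    = (r == rim_seg G (e, false)) || (r == rim_seg G (e, true)).
Proof. by rewrite !inE !orbF. Qed.

Lemma side_in_ribbon e' s e :
  (rib_side e' s \in face (inr e : cell2 S)) = (e == e').
Proof.
rewrite !inE /= [_ == inr (e, false)]xpair_eqE [_ == inr (e, true)]xpair_eqE.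
by rewrite eq_sym; case: eqP; case: s.
Qed.

Lemma card_faces A (a : cell1 S) :
  #|[set d in ribbon_subgraph G A | a \in face d]|
    = (#|[pred v | a \in face (inl v : cell2 S)]|
       + #|[pred e | (e \in A) && (a \in face (inr e : cell2 S))]|)%N.
Proof.
rewrite -!sum1_card !(big_mkcond (fun _ => _ \in _)) big_sumType /=.
by congr (_ + _)%N; apply: eq_bigr => d _; rewrite !inE.
Qed.

(** Every rim cell borders one vertex disk. An end also borders its ribbon, so it is a boundary cell
    only when that ribbon is absent; a side borders its ribbon alone. *)
Lemma boundaryE A :
  (forall h, (seg h \in boundary (ribbon_subgraph G A)) = (h.1 \notin A))
  * (forall h, arc h \in boundary (ribbon_subgraph G A))
  * (forall v, loop v \in boundary (ribbon_subgraph G A))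
  * (forall e s, (rib_side e s \in boundary (ribbon_subgraph G A)) = (e \in A)).
Proof.
have card_vert (r : rim G) :
    #|[pred v | (inl r : cell1 S) \in face (inl v : cell2 S)]| = 1%N.
  by rewrite -(card1 (rim_vert r)); apply: eq_card => v; rewrite inE rim_in_vert.
split; [split; [split|]|].
- move=> [e i]; rewrite inE card_faces card_vert /=.
  have ribE e' : ((seg (e, i)) \in face (inr e' : cell2 S)) = (e' == e).
    rewrite rim_in_ribbon !cell_eqE !xpair_eqE eq_sym.
    by case: eqP; case: i.
  case: (boolP (e \in A)) => eA.
    rewrite (eq_card (B := pred1 e)) ?card1 // => e'.
    by rewrite inE ribE [RHS]inE; case: eqP => [->|_]; rewrite ?eA ?andbF.
  rewrite eq_card0 // => e'; rewrite inE ribE; apply/andP=> -[e'A /eqP ee'].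
  by rewrite -ee' e'A in eA.
- by move=> h; rewrite inE card_faces card_vert eq_card0 // => e;
    rewrite inE rim_in_ribbon andbF.
- by move=> h; rewrite inE card_faces card_vert eq_card0 // => e;
    rewrite inE rim_in_ribbon andbF.
- move=> e s; rewrite inE card_faces eq_card0; last first.
    by move=> v; rewrite inE side_in_vert.
  case: (boolP (e \in A)) => eA.
    rewrite (eq_card (B := pred1 e)) ?card1 // => e'.
    by rewrite inE side_in_ribbon [RHS]inE; case: eqP => [->|_]; rewrite ?eA ?andbF.
  rewrite eq_card0 // => e'; rewrite inE side_in_ribbon.
  by apply/andP=> -[e'A /eqP ee']; rewrite -ee' e'A in eA.
Qed.

(** * Connectedness, and the Lagrangian subspace in terms of cycles *)

Lemma point_of_cell (p : point G) :
  exists a : cell1 S, src a = p \/ tgt a = p.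
Proof.
case: p => [[h s]|v]; last by exists (loop v); left.
exists (seg h); rewrite /=.
case: (eqVneq (entry G h) s) => [<-|hs]; [by left|right].
by move: hs; case: s; case: (entry G h).
Qed.

(** Level false carries a copy of the connected graph of the surface, and the rays lead from there
    to level true. *)
Lemma annular_connected (Gconn : connected_ribbon_graph G) (p q : cell0 F) :
  connect (@adjacent F) p q.
Proof.
have sym := sym_connect_sym (@adjacent_sym F).
have [a0 _] : exists a0 : cell1 S, a0 \in [set: cell1 S].
  by apply/set0Pn; case/andP: Gconn.
pose p0 : cell0 F := (src a0, false).
pose g (r : point G) := connect (@adjacent F) p0 (r, false).
have g_cell (a : cell1 S) : g (src a) = g (tgt a).
  case: a => [r|es]; first exact: connect_cell p0 (circle false r : cell1 F).
  by case: es => e s; apply: connect_cell p0 (side G e s : cell1 F).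
have gT r : g r.
  have [a ar] := point_of_cell r.
  have ga : g (src a) = g (src a0).
    by apply: (@connected_cells_const S _ _ (fun a => g (src a)) g Gconn);
      rewrite ?inE // => b _; rewrite g_cell.
  by case: ar => <-; rewrite -?g_cell ga; apply: connect0.
have p0_connect r : connect (@adjacent F) p0 r.
  case: r => r [|]; last exact: gT.
  by rewrite -(connect_cell p0 (ray r : cell1 F)); apply: gT.
by apply: connect_trans (p0_connect q); rewrite sym.
Qed.

(** A closed curve collapses to a cycle. Conversely, the lift of a cycle is a cycle, which a single
    closed curve represents by connectedness. *)
Lemma pi_EP (Gconn : connected_ribbon_graph G) (v : VE E) :
  v \in pi_E G <-> exists2 x : chain S, bound1 x = 0 & v = surface_vec x.
Proof.
rewrite inE; split=> [/asboolP[s s_closed ->]|[x x0 ->]].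
  exists (collapse (chain_of_curve s)); last exact: curve_vecE.
  by apply: bound1_collapse; apply: bound1_curve.
apply/asboolP.
have [s s_closed sx] := cycle_curve (annular_connected Gconn) (bound1_lift x0).
by exists s; rewrite // curve_vecE sx lift_collapse.
Qed.

(** * Cycles carried by the boundary of a subgraph *)

(* Adding to a cycle the boundaries of ribbons does not change its vector, and
   turns a cycle whose vector lies in the coordinate space of A into one that is
   supported on the boundary of the subgraph A.  If that boundary is connected,
   the new cycle is 0 or the whole boundary. *)
Lemma quasi_tree_surface_vec A (x : chain S) :
  quasi_tree G A -> bound1 x = 0 -> surface_vec x \in coord_space A ->
  surface_vec x = 0.
Proof.
move=> qtA x0 /coord_spaceP[inA outA].
have segA e : e \in A -> x (seg (e, true)) = x (seg (e, false)).
  by move/inA; rewrite ffunE => /F2_addr_eq0.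
have sideA e : e \notin A -> x (rib_side e true) = x (rib_side e false).
  by move/outA; rewrite ffunE => /F2_addr_eq0.
(* On the boundary of the subgraph, [f] is x plus the boundaries of ribbons. The coefficient of
   ribbon e is the common value of x on its ends if e is in A, and on its sides otherwise, so the
   sum vanishes on these cells. *)
pose f (a : cell1 S) : 'F_2 := match a with
  | inl (inl (inl h)) => x a + x (rib_side h.1 false)
  | inl _ => x a
  | inr es => x a + x (seg (es.1, false))
  end.
pose g (p : cell0 S) : 'F_2 := match p with
  | inl c => x (arc (arc_end c))
  | inr v => x (loop v)
  end.
have fg a : a \in boundary (ribbon_subgraph G A) ->
    f a = g (src a) /\ f a = g (tgt a).
  case: a => [[[h|h]|v]|[e s]] //.
  - rewrite boundaryE => hA; rewrite /= !(cycle_corner _ x0) /=.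
    by case: (entry G h); rewrite ?sideA.
  - by move=> _; rewrite /= arc_end_src arc_end_tgt.
  - rewrite boundaryE => eA; rewrite /= !(cycle_corner _ x0) /= segA //.
    by rewrite addrC.
have f_const := connected_cells_const qtA fg.
apply/ffunP=> -[e|e]; rewrite [RHS]ffunE; case: (boolP (e \in A)) => eA.
- exact: inA.
(* Both ends of e lie on the boundary, where [f] is constant; the term added to x is the same on
   both, so x agrees on them. *)
- rewrite ffunE; have /addIr -> : f (seg (e, false)) = f (seg (e, true)).
    by apply: f_const; rewrite boundaryE.
  exact: addFF.
- rewrite ffunE; have /addIr -> : f (rib_side e false) = f (rib_side e true).
    by apply: f_const; rewrite boundaryE.
  exact: addFF.
- exact: outA.
Qed.

Definition incident (p : cell0 S) (a : cell1 S) : Prop := src a = p \/ tgt a = p.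

Lemma incident_touch p a b : incident p a -> incident p b -> touch a b.
Proof. by rewrite /touch => -[->|->] [->|->]; rewrite eqxx ?orbT. Qed.

Lemma incident_seg h s : incident (inl (h, s)) (seg h).
Proof.
rewrite /incident /=; case: (eqVneq (entry G h) s) => [->|hs]; [by left|right].
by move: hs; case: s; case: (entry G h).
Qed.

Lemma incident_arc (c : (E * bool) * bool) :
  incident (inl c) (arc (arc_end c)).
Proof.
case: c => h s; rewrite /incident /arc_end /=.
case: eqVneq => [->|hs]; [by right; rewrite permKV|left].
by move: hs; case: s; case: (entry G h).
Qed.

Lemma incident_side e i s : incident (inl ((e, i), s)) (rib_side e s).
Proof. by rewrite /incident /=; case: i; [right|left]. Qed.

(* The vector of a component of the boundary of the subgraph A vanishes only if
   the component meets no ribbon or all four corners of it; as the surface is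
   connected, the component is then the whole boundary. *)
Lemma not_quasi_tree_surface_vec A (Gconn : connected_ribbon_graph G) :
  ~~ quasi_tree G A ->
  exists x : chain S, [/\ bound1 x = 0, surface_vec x \in coord_space A
                        & surface_vec x != 0].
Proof.
set X := boundary (ribbon_subgraph G A).
(* The boundary contains all arcs and loops, so it can only fail to be connected through two cells
   that no path joins. *)
have X_neq0 : X != set0.
  case/andP: Gconn => /set0Pn[[[[h|h]|v]|[e s]] _] _; apply/set0Pn.
  - by exists (arc h); rewrite boundaryE.
  - by exists (arc h); rewrite boundaryE.
  - by exists (loop v); rewrite boundaryE.
  (* The pair (e, s) now denotes an end of the ribbon e instead of a side. *)
  - by exists (arc (e, s)); rewrite boundaryE.
rewrite /quasi_tree /connected_cells -/X X_neq0 /= negb_forall_in.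
case/exists_inP=> a aX; rewrite negb_forall_in => /exists_inP[b bX nab].
pose R := [rel x y | [&& x \in X, y \in X & @touch S x y]].
pose C := [set c in X | connect R a c].
have in_C c : (c \in C) = (c \in X) && connect R a c by exact: in_set.
have C_touch c d : c \in X -> d \in X -> touch c d -> (c \in C) = (d \in C).
  move=> cX dX cd; rewrite !in_C cX dX /=.
  have R_sym : symmetric R.
    move=> c' d'; rewrite /= andbCA; congr [&& _, _ & _].
    rewrite /touch ![src d' == _]eq_sym ![tgt d' == _]eq_sym.
    by case: (src c' == src d'); case: (src c' == tgt d');
       case: (tgt c' == src d'); case: (tgt c' == tgt d').
  apply: (same_connect_r (sym_connect_sym R_sym)).
  by apply: connect1; rewrite /= cX dX.
have CX c : c \notin X -> (c \in C) = false by rewrite in_C => /negPf ->.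
have C_seg h s : h.1 \notin A -> (seg h \in C) = (arc (arc_end (h, s)) \in C).
  move=> hA; apply: C_touch; rewrite ?boundaryE //.
  exact: incident_touch (incident_seg h s) (incident_arc (h, s)).
have C_side e i s : e \in A ->
    (rib_side e s \in C) = (arc (arc_end ((e, i), s)) \in C).
  move=> eA; apply: C_touch; rewrite ?boundaryE //.
  exact: incident_touch (incident_side e i s) (incident_arc ((e, i), s)).
exists (chain_of_set C); split.
(* At a corner, X contains the arc and exactly one of the end and the side; these two touch, so both
   or neither are in C. *)
- apply: bound1_eq0 => -[[e i] s] /=; rewrite !ffunE.
  case: (boolP (e \in A)) => eA.
    by rewrite (C_side e i) // CX ?boundaryE ?eA // add0r addFF.
  by rewrite (C_seg _ s) // [inr _ \in C]CX ?boundaryE // addr0 addFF.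
- apply/coord_spaceP; split=> e eA; rewrite !ffunE !CX ?boundaryE ?eA //;
    exact: addr0.
apply/eqP=> /ffunP vec0; case/negP: nab.
(* If the vector is 0, membership in C extends to a function of the points that is constant along
   every cell of the connected surface; hence b lies in C because a does. *)
pose g (p : cell0 S) : bool := match p with
  | inl c => arc (arc_end c) \in C
  | inr v => loop v \in C
  end.
have gC c : c \in X -> (c \in C) = g (src c).
  case: c => [[[h|h]|v]|[e s]]; rewrite ?boundaryE //=.
  - exact: C_seg.
  - by rewrite arc_end_src.
  - exact: C_side.
(* For cells outside X the vanishing vector is needed: a side with e outside A compares the two ends
   of e, and an end with e in A compares the two sides. *)
have g_cell c : g (src c) = g (tgt c).
  case: c => [[[[e i]|h]|v]|[e s]] //=; last first.
  - case: (boolP (e \in A)) => eA; first by rewrite -!C_side.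
    rewrite -!C_seg //; apply: F2_bool_inj; apply: F2_addr_eq0.
    by have := vec0 (inl e); rewrite !ffunE.
  - by rewrite arc_end_src arc_end_tgt.
  case: (boolP (e \in A)) => eA; last by rewrite -!C_seg.
  have side_eq : (rib_side e false \in C) = (rib_side e true \in C).
    apply: F2_bool_inj; apply: F2_addr_eq0.
    by have := vec0 (inr e); rewrite !ffunE.
  by rewrite -!C_side //; case: (entry G _).
suff : b \in C by rewrite in_C => /andP[].
have -> : (b \in C) = (a \in C).
  rewrite !gC //; apply: (connected_cells_const (f := fun c => g (src c)) (g := g) Gconn);
  rewrite ?inE // => c _; by rewrite g_cell.
by rewrite in_C aX connect0.
Qed.

End Surfaces.

Theorem theorem3p1 (E : finType) (G : ribbon_graph E)
    (Gconn : connected_ribbon_graph G) :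
  rho_E G = nu_E (pi_E G).
Proof.
apply/setP=> A; rewrite [LHS]inE [RHS]inE; apply/idP/eqP => [qtA|nuA].
  apply/setP=> v; rewrite in_set in_set1; apply/andP/eqP => [[/(pi_EP Gconn)[x x0 ->]]|->].
    exact: quasi_tree_surface_vec.
  split; last exact: mem0v.
  apply/(pi_EP Gconn); exists 0; last by apply/ffunP=> -[e|e]; rewrite !ffunE addr0.
  by apply/ffunP=> p; rewrite ffunE big1 ?ffunE // => a _; rewrite ffunE mul0r.
apply: contraT => /(not_quasi_tree_surface_vec Gconn)[x [x0 xA /eqP[]]].
apply/set1P; rewrite -nuA in_set xA andbT.
by apply/(pi_EP Gconn); exists x.
Qed.
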